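(* Let $k,s$ be non-negative integers, $n=k+s$, and let $\ell$ satisfy $s \le \ell < n/2$ (and $\ell\ge 1$). Suppose the set of spies in a room of $n$ people labelled $1,\dots,n$ is a uniformly random $s$-element subset of $\{1,\dots,n\}$ (the rest being knights), and a questioner follows the Spider Interrogation Strategy with parameter $\ell$. Suppose the spies either all act knavishly, or all act spyishly. Then for each $q$, the probability that the questioner asks exactly $q$ questions is the same in the knavish case as in the spyish case. In either case, the expected number of questions saved, i.e. the expected value of $n+\ell-1$ minus the number of questions asked, is \[ \frac{1}{\binom{k+s}{s}} \sum_{r=0}^{s-1} \binom{k+s}{r}. \]
   Context: Setting: each person is a knight or a spy; knights always answer truthfully. Questions have the form ''Person $i$, what is the identity of person $j$?'', answered ''knight'' (a support) or ''spy'' (an accusation). Spies act knavishly if they always answer falsely, and spyishly if they always answer ''spy''. A person is ''involved'' once he has been a candidate or has been asked a question; the choice of which uninvolved person to use next in the strategy is made without knowledge of identities. Spider Interrogation Strategy (for at most $\ell$ spies). Step 1: Keep a threshold $L$, initially $L=\ell$. Choose as candidate a person not yet involved, and repeatedly ask new people about the candidate until either (a) strictly more people have accused the candidate than have supported him, or (b) $L$ people have supported him. In case (a), with $a$ accusers and $a-1$ supporters, reject the candidate, set aside the $2a$ people involved, replace $L$ by $L-a$ and repeat Step 1 with a new candidate. In case (b) accept the candidate, person $k$ (necessarily a knight). Step 2: ask $k$ about each person not involved in Step 1 and about each rejected candidate. Step 3: for each rejected candidate $m$ with $a$ accusers: if $m$ is a knight ask $k$ about the $a-1$ supporters of $m$;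 if $m$ is a spy ask $k$ about the $a$ accusers of $m$. Step 4: ask $k$ about each person who supported his candidacy. The number of questions asked never exceeds $n+\ell-1$. *)

(* Defs.v *)
From mathcomp Require Import all_boot all_order all_algebra.

Set Implicit Arguments.
Unset Strict Implicit.
Unset Printing Implicit Defensive.

Import GRing.Theory.

(* How all the spies answer. *)
Variant behaviour := Knavish | Spyish.

(* [answer b S i j] is person [i]'s reply when asked for the identity of person
   [j], if [S] is the set of spies: [true] is "knight" (a support) and [false]
   is "spy" (an accusation). *)
Definition answer (T : finType) (b : behaviour) (S : {set T}) (i j : T) : bool :=
  if i \in S then
    match b with Knavish => j \in S | Spyish => false end
  else j \notin S.

(* [polled] lists the people asked about the candidate with their replies, the
   most recent first. *)
Record candidacy (T : Type) :=
  Candidacy { candidate : T; polled : seq (T * bool) }.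

Definition supporters (T : Type) (c : candidacy T) : seq T :=
  [seq x.1 | x <- polled c & x.2].

Definition accusers (T : Type) (c : candidacy T) : seq T :=
  [seq x.1 | x <- polled c & ~~ x.2].

(* The candidacies so far, the most recent first; they contain everything the
   questioner has learnt during Step 1. *)
Definition history (T : Type) := seq (candidacy T).

Definition involved (T : Type) (h : history T) : seq T :=
  flatten [seq candidate c :: unzip1 (polled c) | c <- h].

(* A rule choosing the next person to use in Step 1, be it a candidate or
   someone to be asked about the current candidate. It may depend on all the
   replies received so far, but on nothing else about the identities. *)
Definition selection_rule (T : Type) := history T -> T.

Definition picks_uninvolved (T : finType) (pick : selection_rule T) : Prop :=
  forall h : history T,
    (exists i : T, i \notin involved h) -> pick h \notin involved h.

(* Step 1 with threshold [L], rejected candidacies [rej] and current candidacy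
   [c]; the result is the final [rej] and the accepted candidacy. Every
   recursive call involves a new person, and when the initial threshold is less
   than half of the number of people a candidate is accepted before everybody
   has been involved; so [fuel := #|T|] is never exhausted. *)
Fixpoint step1 (T : Type) (pick : selection_rule T) (ans : T -> T -> bool)
    (fuel L : nat) (rej : history T) (c : candidacy T) :
    history T * candidacy T :=
  if fuel is fuel'.+1 then
    let a := size (accusers c) in
    if size (supporters c) < a then
      step1 pick ans fuel' (L - a) (c :: rej)
        (Candidacy (pick (c :: rej)) [::])
    else if L <= size (supporters c) then (rej, c)
    else
      let i := pick (c :: rej) in
      step1 pick ans fuel' L rej
        (Candidacy (candidate c) ((i, ans i (candidate c)) :: polled c))
  else (rej, c).

(* The questions (person asked, person asked about) of the Spider Interrogation
   Strategy for at most [l] spies. *)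
Definition spider_questions (T : finType) (pick : selection_rule T)
    (ans : T -> T -> bool) (l : nat) : seq (T * T) :=
  let: (rej, acc) :=
    step1 pick ans #|T| l [::] (Candidacy (pick [::]) [::]) in
  let k := candidate acc in
  let q1 := flatten [seq [seq (x.1, candidate c) | x <- polled c]
                    | c <- acc :: rej] in
  let q2 := [seq (k, j) | j <- enum T & j \notin involved (acc :: rej)]
            ++ [seq (k, candidate m) | m <- rej] in
  let q3 := flatten [seq [seq (k, j) | j <- if ans k (candidate m)
                                            then supporters m
                                            else accusers m]
                    | m <- rej] in
  let q4 := [seq (k, j) | j <- supporters acc] in
  q1 ++ q2 ++ q3 ++ q4.

Definition num_questions (T : finType) (pick : selection_rule T) (l : nat)
    (b : behaviour) (S : {set T}) : nat :=
  size (spider_questions pick (answer b S) l).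

Definition spy_sets (T : finType) (s : nat) : {set {set T}} :=
  [set S : {set T} | #|S| == s].

(* Probability and expectation for a uniformly random [s]-subset of [T]. *)
Definition prob (T : finType) (s : nat) (E : pred {set T}) : rat :=
  (#|[set S in spy_sets T s | E S]|%:R / #|spy_sets T s|%:R)%R.

Definition expectation (T : finType) (s : nat) (X : {set T} -> rat) : rat :=
  ((\sum_(S in spy_sets T s) X S) / #|spy_sets T s|%:R)%R.

(* Main.v *)
(** Counting the questions shows that the number saved is the number of knights
    rejected as candidates. Read the people in the order in which Step 1
    involves them as a walk, a knight being a step up and a spy a step down; as
    a selected person is a uniformly random uninvolved one, every order of
    steps is equally likely, whatever the selection rule. For knavish spies the
    candidacies are the excursions of the walk from 0, and rejected knights are
    steps from 1 to 0. For spyish spies only a spy candidate differs: he is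
    rejected by the next person asked, so that the walk jumps from -1 to 0.

    The key fact concerns the number of steps from 1 to 0 in a walk with given
    numbers of up- and down-steps: its distribution does not depend on the
    starting height z, as long as z <= 1 and the final height is at least 0. It
    follows, by induction on the number of down-steps, from comparing the
    decomposition by the first step at z with that by the last step at z + 1.
    Restarting from 0 instead of -2 when a spyish spy accuses a spy candidate
    therefore changes nothing. *)
Require Import Defs.
From mathcomp Require Import all_boot all_order all_algebra.
From mathcomp Require Import zify.

Set Implicit Arguments.
Unset Strict Implicit.
Unset Printing Implicit Defensive.

Import Order.TTheory GRing.Theory Num.Theory.

Local Open Scope ring_scope.

(** * Walk sums and their independence of the starting height *)

Definition spy_step (b : behaviour) (z : int) : int :=
  match b with
  | Knavish => z - 1
  | Spyish => if z == -1 then 0 else z - 1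
  end.

(* The sum, over the walks from height [z] with [n] steps of which [s] are down,
   of [psi (j + number of steps from 1 to 0)]. Such walks are the orders in
   which [n] uninvolved people, of whom [s] are spies, can appear. *)
Fixpoint walk_sum (R : nmodType) (psi : nat -> R) (b : behaviour)
    (n : nat) (z : int) (s j : nat) : R :=
  if n is n'.+1 then
    walk_sum psi b n' (z + 1) s j
    + (if s is s'.+1 then
         walk_sum psi b n' (spy_step b z) s' (j + (z == 1)%R)%N
       else 0)
  else if s is 0 then psi j else 0.

Section WalkSum.

Variables (R : nmodType) (psi : nat -> R).

Lemma walk_sum0 b n z j : walk_sum psi b n z 0 j = psi j.
Proof. by elim: n z => //= n IHn z; rewrite IHn addr0. Qed.

(** With only [s] down-steps the walk stays positive, so it makes no step from 1 to 0 and the two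
    behaviours agree. *)
Lemma walk_sum_high b n z s j :
  s%:Z < z -> walk_sum psi b n z s j = psi j *+ 'C(n, s).
Proof.
elim: n z s => [|n IHn] z [|s] /= sz; rewrite ?bin0 ?mulr1n //.
  by rewrite walk_sum0 addr0.
have -> : spy_step b z = z - 1 by case: b {IHn} => //=; case: eqP => //; lia.
have -> : (z == 1) = false by lia.
rewrite addn0 !IHn; [|lia|lia].
by rewrite binS mulrnDr.
Qed.

(** The final height is fixed by the numbers of steps, so a last step down goes from 1 to 0 exactly
    when that height is 0. *)
Lemma walk_sum_last n z s j :
  walk_sum psi Knavish n.+1 z s j =
  walk_sum psi Knavish n z s j
  + (if s is s'.+1 then
       walk_sum psi Knavish n z s' (j + (z + n.+1%:Z == s.*2%:Z)%R)%N
     else 0).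
Proof.
elim: n z s j => [|n IHn] z s j.
  case: s => [|[|s]] //=; rewrite !add0r.
  by congr (psi (j + nat_of_bool _)); apply/eqP/eqP; lia.
have -> : walk_sum psi Knavish n.+2 z s j =
    walk_sum psi Knavish n.+1 (z + 1) s j
    + (if s is s'.+1 then
         walk_sum psi Knavish n.+1 (z - 1) s' (j + (z == 1)%R)%N
       else 0) by [].
rewrite IHn.
case: s => [|s]; first by rewrite !walk_sum0 !addr0.
rewrite IHn [in RHS]/=.
have -> : (z + 1 + n.+1 == s.+1.*2) = (z + n.+2 == s.+1.*2) by apply/eqP/eqP; lia.
case: s => [|s] /=; first by rewrite !addr0 addrAC.
rewrite addrACA.
have -> : (z - 1 + n.+1 == s.+1.*2) = (z + n.+2 == s.+2.*2) by apply/eqP/eqP; lia.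
by rewrite addnAC.
Qed.

(** Split by the first step on the left and by the last step on the right: neither is a step from 1
    to 0, and the terms ending in an up-step agree. The others start at [z - 1] and [z + 1] with one
    down-step fewer, two shifts apart. *)
Lemma walk_sum_shift n z s j :
  z <= 0 -> s.*2%:Z <= z + n%:Z ->
  walk_sum psi Knavish n z s j = walk_sum psi Knavish n (z + 1) s j.
Proof.
elim: s n z j => [|s IHs] n z j z0 zn; first by rewrite !walk_sum0.
case: n zn => [|n] zn; first by lia.
rewrite [RHS]walk_sum_last /=.
have -> : (z == 1) = false by lia.
have -> : (z + 1 + n.+1 == s.+1.*2) = false by lia.
rewrite !addn0 (IHs n (z - 1)); [|lia|lia].
by rewrite subrK (IHs n z); [|lia|lia].
Qed.

(** The walks differ only in the down-step from -1, which leads to 0 or to -2; two shifts, through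
    -1, identify the sums from there. *)
Lemma walk_sum_spyish n z s j :
  -1 <= z -> s.*2%:Z < z + n%:Z ->
  walk_sum psi Spyish n z s j = walk_sum psi Knavish n z s j.
Proof.
elim: n z s j => [|n IHn] z s j z1 zn //=.
case: s zn => [|s] zn; first by rewrite !walk_sum0.
rewrite IHn; [|lia|lia]; congr (_ + _).
case: eqP => [zE|zE]; last by apply: IHn; lia.
rewrite IHn; [|lia|lia].
rewrite zE (@walk_sum_shift n (-1 - 1)); [|lia|lia].
by rewrite subrK (@walk_sum_shift n (-1)); [|lia|lia].
Qed.

End WalkSum.

(** * The total number of steps from 1 to 0 *)

Definition bin_psum (n m : nat) : nat := \sum_(r < m) 'C(n, r).

Lemma bin_psumS n m : bin_psum n.+1 m = (bin_psum n m + bin_psum n m.-1)%N.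
Proof.
case: m => [|m]; first by rewrite /bin_psum !big_ord0.
rewrite /bin_psum /= !big_ord_recl !bin0 -addnA; congr (_ + _)%N.
by rewrite -big_split /=; apply: eq_bigr => i _; rewrite binS.
Qed.

(* By the reflection principle the total number of steps from 1 to 0 depends only
   on [n] and [d = |z - 1| + |e|], where [e = z + n - 2s] is the final height, and
   it is the sum of 'C(n, r) over [2r < n - d]; [level_bound] is the number of
   terms. *)
Definition level_bound (n : nat) (z : int) (s : nat) : nat :=
  match z with
  | Posz 0 => minn s (n - s)
  | Posz m.+1 => minn (s - m) (n.+1 - s)
  | Negz m => minn s (n - s - m.+1)
  end.

Lemma level_bound_le0 n z s :
  z <= 0 -> level_bound n z s = minn s (n - s - `|z|)%N.
Proof. by case: z => [[|m]|m] //=; rewrite subn0. Qed.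

Lemma level_bound_gt0 n z s :
  0 < z -> level_bound n z s = minn (s - `|z|.-1) (n.+1 - s).
Proof. by case: z => [[|m]|m]. Qed.

(** After a first step, the bounds are [b] and [b.-1] in some order, as [bin_psumS] requires. At
    [z = 1] both are [b.-1], and the step from 1 to 0 supplies the missing binomial. *)
Lemma walk_sum_mean (R : pzSemiRingType) n z s j :
  walk_sum (fun i => i%:R : R) Knavish n z s j =
  (bin_psum n (level_bound n z s) + j * 'C(n, s))%:R.
Proof.
elim: n z s j => [|n IHn] z s j.
  have -> : level_bound 0 z s = 0%N.
    by case: (lerP z 0) => ?; [rewrite level_bound_le0|rewrite level_bound_gt0];
       lia.
  by rewrite /bin_psum big_ord0; case: s => [|s] /=; rewrite ?muln1 ?muln0.
case: s => [|s].
  rewrite walk_sum0 bin0 muln1.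
  have -> : level_bound n.+1 z 0 = 0%N.
    by case: (lerP z 0) => ?; [rewrite level_bound_le0|rewrite level_bound_gt0];
       lia.
  by rewrite /bin_psum big_ord0.
rewrite /= !IHn -natrD; congr (_%:R); rewrite bin_psumS binS.
set b := level_bound n.+1 z s.+1.
have [z1|zN1] := eqVneq z 1.
  have -> : level_bound n (z + 1) s.+1 = b.-1 by rewrite /b !level_bound_gt0; lia.
  have -> : level_bound n (z - 1) s = b.-1.
    by rewrite /b level_bound_le0 ?level_bound_gt0; lia.
  have -> : (bin_psum n b = bin_psum n b.-1 + 'C(n, s))%N.
    have bE : b = minn s.+1 (n.+1 - s) by rewrite /b level_bound_gt0; lia.
    (* For [s > n] the binomial vanishes, and truncated subtraction makes [b] zero. *)
    have [sn|ns] := leqP s n; last first.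
      by rewrite bin_small // addn0; congr bin_psum; lia.
    case: b bE => [|b] /= bE; first lia.
    rewrite {1}/bin_psum big_ord_recr /=; congr (_ + _)%N.
    have [->//|->] : b = s \/ b = (n - s)%N by lia.
    by rewrite bin_sub.
  lia.
have [z0|z0] := lerP z 0.
  have -> : level_bound n (z + 1) s.+1 = b.
    rewrite /b [RHS]level_bound_le0 //.
    by case: (lerP (z + 1) 0) => ?;
       [rewrite level_bound_le0|rewrite level_bound_gt0]; lia.
  have -> : level_bound n (z - 1) s = b.-1 by rewrite /b !level_bound_le0; lia.
  lia.
have -> : level_bound n (z + 1) s.+1 = b.-1 by rewrite /b !level_bound_gt0; lia.
have -> : level_bound n (z - 1) s = b by rewrite /b !level_bound_gt0; lia.
lia.
Qed.

Close Scope ring_scope.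

(** * Counting the questions for a given outcome of Step 1 *)

Section Interrogation.

Variable T : finType.
Implicit Types (S B X U : {set T}) (c m : candidacy T) (rej h : history T).

(** Reveals whether [i] is a spy. The remaining spies again range over all subsets of one size,
    whichever [i] was selected. *)
Lemma sum_subsets_split (R : nmodType) U s i (G : {set T} -> R) : i \in U ->
  (\sum_(X : {set T} | (X \subset U) && (#|X| == s)) G X =
   \sum_(X : {set T} | (X \subset U :\ i) && (#|X| == s)) G X +
   (if s is s'.+1 then
      \sum_(X : {set T} | (X \subset U :\ i) && (#|X| == s')) G (i |: X)
    else 0))%R.
Proof.
move=> iU; rewrite (bigID (fun X => i \notin X)) /=; congr (_ + _)%R.
  by apply: eq_bigl => X; rewrite subsetD1 andbAC.
case: s => [|s].
  by apply: big1 => X /andP[/andP[_ /eqP/cards0_eq->]]; rewrite inE.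
rewrite (reindex_onto (fun X => i |: X) (fun X => X :\ i)) /=; last first.
  by move=> X /andP[_]; rewrite negbK => /setD1K.
apply: eq_bigl => X; rewrite setU11 /= andbT subsetD1.
have [iX|iX] := boolP (i \in X).
  rewrite andbF; apply/negP => /andP[_ /eqP XE].
  by rewrite -XE !inE eqxx in iX.
by rewrite setU1K // eqxx andbT cardsU1 iX eqSS subUset sub1set iU andbT.
Qed.

(* [spider_questions] as a function of the outcome of Step 1. *)
Definition questions (ans : T -> T -> bool) (r : history T * candidacy T) :
    seq (T * T) :=
  let: (rej, acc) := r in
  let k := candidate acc in
  let q1 := flatten [seq [seq (x.1, candidate c) | x <- polled c]
                    | c <- acc :: rej] in
  let q2 := [seq (k, j) | j <- enum T & j \notin involved (acc :: rej)]
            ++ [seq (k, candidate m) | m <- rej] in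
  let q3 := flatten [seq [seq (k, j) | j <- if ans k (candidate m)
                                            then supporters m
                                            else accusers m]
                    | m <- rej] in
  let q4 := [seq (k, j) | j <- supporters acc] in
  q1 ++ q2 ++ q3 ++ q4.

Definition rejected_knights S rej : nat :=
  count (fun m => candidate m \notin S) rej.

Lemma size_involved_cons c h :
  size (involved (c :: h)) =
  (size (supporters c) + size (accusers c) + size (involved h)).+1.
Proof.
rewrite /involved /= size_cat size_map /supporters /accusers !size_map.
by rewrite !size_filter (count_predC (fun x => x.2)).
Qed.

Lemma involved_cons c h :
  involved (c :: h) = candidate c :: unzip1 (polled c) ++ involved h.
Proof. by []. Qed.

Lemma eq_rejected_knights S S' h :
  {in involved h, S =i S'} -> rejected_knights S h = rejected_knights S' h.
Proof.
rewrite /rejected_knights; elim: h => //= c h IHh SS'.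
rewrite involved_cons in SS'; rewrite (SS' _ (mem_head _ _)) IHh // => x xh.
by apply: SS'; rewrite inE mem_cat xh !orbT.
Qed.

Definition balanced m : bool := size (accusers m) == (size (supporters m)).+1.

(** [q1] and [q2] contain one question for each person except the accepted candidate: polled people
    answer it, the others are its subject. [q3] and [q4] would contain [l] if each rejected [m] cost
    [size (accusers m)]; balance makes a knight cost one less. *)
Lemma size_questions b S l rej acc :
  uniq (involved (acc :: rej)) -> all balanced rej ->
  size (supporters acc) + \sum_(m <- rej) size (accusers m) = l ->
  candidate acc \notin S ->
  (size (questions (answer b S) (rej, acc)) + rejected_knights S rej).+1
    = #|T| + l.
Proof.
move=> uI bal <- accS; rewrite /questions /= !size_cat !size_map.
have -> : size [seq j <- enum T | j \notin involved (acc :: rej)]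
          = #|T| - size (involved (acc :: rej)).
  rewrite -(card_uniqP uI) -(cardC (mem (involved (acc :: rej)))) addKn.
  by rewrite enumT cardE; congr size; apply: eq_filter.
have : size (involved (acc :: rej)) <= #|T|.
  by rewrite -(card_uniqP uI) max_card.
rewrite !size_involved_cons.
have -> : size (polled acc) = size (supporters acc) + size (accusers acc).
  rewrite /supporters /accusers !size_map !size_filter.
  by rewrite (count_predC (fun x => x.2)).
have E1 : size (flatten [seq [seq (x.1, candidate c) | x <- polled c] | c <- rej])
     + size rej = size (involved rej).
  elim: rej {uI bal} => //= c h IHh; rewrite size_cat size_map.
  by rewrite size_cat size_map -/(involved h) -IHh; lia.
have E2 : size (involved rej) = (\sum_(m <- rej) size (accusers m)).*2.
  elim: rej bal {uI E1} => [|c h IHh]; first by rewrite big_nil.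
  move=> /andP[/eqP bc /IHh bh]; rewrite size_involved_cons big_cons.
  by move: bh bc; lia.
have : size (flatten [seq [seq (candidate acc, j) | j <-
          if answer b S (candidate acc) (candidate m)
          then supporters m else accusers m] | m <- rej])
     + rejected_knights S rej = \sum_(m <- rej) size (accusers m).
  elim: rej bal {uI E1 E2} => [|c h IHh] /=; first by rewrite big_nil.
  move=> /andP[/eqP bc /IHh bh]; rewrite size_cat size_map big_cons -bh.
  rewrite /rejected_knights /= /answer (negbTE accS).
  by case: ifP => cS; rewrite bc /=; lia.
have : size (supporters acc) = size [seq x <- polled acc | x.2].
  by rewrite size_map.
move: E1 E2.
move: (size (flatten _)) (size (flatten _)) (\sum_(_ <- _) _) (size (filter _ _)).
move: (size (involved _)) (size (supporters _)) (rejected_knights _ _).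
move: (size rej) (size (accusers acc)) #|T|; lia.
Qed.

(** * The state of Step 1 and its change when one person is revealed *)

Variable pick : selection_rule T.
Hypothesis pick_new : picks_uninvolved pick.

Definition uninvolved h : {set T} := [set x | x \notin involved h].

(* [B] is the set of the involved people who are spies. *)
Definition height B c : int :=
  let d := ((size (supporters c)).+1%:Z - (size (accusers c))%:Z)%R in
  if candidate c \in B then (- d)%R else d.

(** The second term counts a knight already outvoted but not yet moved to [rej], so the count grows
    at the step from 1 to 0 itself. *)
Definition rejections B rej c : nat :=
  rejected_knights B rej
  + ((size (supporters c) < size (accusers c)) && (candidate c \notin B)).

(* [s] is the number of uninvolved spies. A candidate who is a spy counts as
   [(size (supporters c)).+1] spies: knavish supporters are spies, and a spyish
   candidate has no supporters. *)
Record invariant (b : behaviour) (l : nat) B (s L : nat) rej c : Prop := {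
  inv_uniq : uniq (involved (c :: rej));
  inv_spies : B \subset involved (c :: rej);
  inv_balanced : all balanced rej;
  inv_threshold : L + \sum_(m <- rej) size (accusers m) = l;
  inv_supporters : size (supporters c) <= L;
  inv_accusers : size (accusers c) <= (size (supporters c)).+1;
  inv_bound : s + (if candidate c \in B then (size (supporters c)).+1
                   else size (accusers c)) <= L;
  inv_spyish : b = Spyish -> candidate c \in B -> size (supporters c) = 0;
  inv_size : L.*2 + size (involved rej) < #|T|
}.

Definition reveal B (i : T) (spy : bool) : {set T} :=
  if spy then i |: B else B.

Lemma in_reveal B i spy x : x != i -> (x \in reveal B i spy) = (x \in B).
Proof. by case: spy => //= /negbTE xi; rewrite !inE xi. Qed.

Lemma in_reveal_self B i spy : i \notin B -> (i \in reveal B i spy) = spy.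
Proof. by case: spy => [|/negbTE//]; rewrite /= setU11. Qed.

Lemma pick_uninvolved h :
  size (involved h) < #|T| -> pick h \in uninvolved h.
Proof.
move=> ltT; rewrite inE; apply: pick_new.
have /existsP[i iN] : [exists i, i \notin involved h]; last by exists i.
apply: contraLR ltT => /existsPn Ih; rewrite -leqNgt.
apply: leq_trans (card_size _); apply/subset_leq_card/subsetP => i _.
by have := Ih i; rewrite negbK.
Qed.

Lemma size_supporters_cons c x i r :
  size (supporters (Candidacy x ((i, r) :: polled c))) = size (supporters c) + r.
Proof. by case: r => /=; rewrite ?addn1 ?addn0. Qed.

Lemma size_accusers_cons c x i r :
  size (accusers (Candidacy x ((i, r) :: polled c))) = size (accusers c) + ~~ r.
Proof. by case: r => /=; rewrite ?addn1 ?addn0. Qed.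

Lemma spies_notin B h i : B \subset involved h -> i \in uninvolved h -> i \notin B.
Proof. by move=> /subsetP BI; rewrite inE; apply/contra/BI. Qed.

Lemma candidate_neq c rej i : i \in uninvolved (c :: rej) -> candidate c != i.
Proof. by rewrite inE involved_cons inE negb_or eq_sym => /andP[]. Qed.

Lemma rejected_knights_reveal B h i spy :
  i \in uninvolved h ->
  rejected_knights (reveal B i spy) h = rejected_knights B h.
Proof.
rewrite inE => iN; apply: eq_rejected_knights => x xh.
by apply: in_reveal; apply: contraNneq iN => <-.
Qed.

Definition poll b B c i spy : candidacy T :=
  Candidacy (candidate c)
    ((i, answer b (reveal B i spy) i (candidate c)) :: polled c).

Lemma involved_poll c rej i x :
  involved (Candidacy (candidate c) ((i, x) :: polled c) :: rej)
    =i i :: involved (c :: rej).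
Proof. by move=> y; rewrite !involved_cons /= !inE orbCA. Qed.

Lemma uninvolved_poll c rej i x :
  uninvolved (Candidacy (candidate c) ((i, x) :: polled c) :: rej)
    = uninvolved (c :: rej) :\ i.
Proof. by apply/setP => y; rewrite in_setD1 !in_set involved_poll in_cons negb_or. Qed.

Lemma uninvolved_next h i :
  uninvolved (Candidacy i [::] :: h) = uninvolved h :\ i.
Proof. by apply/setP => y; rewrite in_setD1 !in_set involved_cons in_cons negb_or. Qed.

Lemma reveal_subset B i spy (r r' : seq T) : B \subset r ->
  r' =i i :: r -> reveal B i spy \subset r'.
Proof.
move=> /subsetP Br r'E; apply/subsetP => x; rewrite r'E inE.
by case: spy => [|/Br->]; rewrite ?orbT //= !inE => /orP[->|/Br->]; rewrite ?orbT.
Qed.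

Lemma answer_reveal b B c rej i spy :
  B \subset involved (c :: rej) -> i \in uninvolved (c :: rej) ->
  answer b (reveal B i spy) i (candidate c) =
  if spy then (if b is Knavish then candidate c \in B else false)
  else candidate c \notin B.
Proof.
move=> BI iU; rewrite /answer in_reveal_self; last exact: spies_notin iU.
by rewrite in_reveal ?(candidate_neq iU).
Qed.

Lemma invariant_poll b l B s (spy : bool) L rej c i :
  invariant b l B (s + spy) L rej c ->
  size (accusers c) <= size (supporters c) < L ->
  i \in uninvolved (c :: rej) ->
  invariant b l (reveal B i spy) s L rej (poll b B c i spy).
Proof.
case=> uI BI bal thr _ _ bnd spyish sz /andP[ap pL] iU.
have ci := candidate_neq iU.
have ans := answer_reveal b spy BI iU.
split=> //; rewrite /poll ?size_supporters_cons ?size_accusers_cons /=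
  ?in_reveal // ?ans.
- move: uI iU; rewrite in_set !involved_cons /= !inE !negb_or.
  by case/andP=> -> -> /andP[ic ->]; rewrite eq_sym ic.
- exact/(reveal_subset _ BI)/involved_poll.
- by apply: leq_trans pL; rewrite -addn1 leq_add2l leq_b1.
- by rewrite -addn1 leq_add ?leq_b1 // (leq_trans ap) ?leq_addr.
(* A revealed spy leaves [s] and adds at most one supporter of a spy candidate or one accuser of a
   knight; a revealed knight adds neither. *)
- move: bnd; clear; move: (size _) (size _) (_ \in _) => p a cB.
  by case: spy; case: b; case: cB => /=; lia.
- by move=> bE cB; rewrite (spyish bE cB) bE cB; case: (spy).
Qed.

Lemma height_poll b l B s (spy : bool) L rej c i :
  invariant b l B s L rej c ->
  size (accusers c) <= size (supporters c) ->
  i \in uninvolved (c :: rej) ->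
  height (reveal B i spy) (poll b B c i spy) =
  if spy then spy_step b (height B c) else (height B c + 1)%R.
Proof.
case=> uI BI bal thr _ _ bnd spyish sz ap iU.
have ci := candidate_neq iU.
have ans := answer_reveal b spy BI iU.
rewrite /height /poll in_reveal //= ans size_supporters_cons size_accusers_cons.
case: (boolP (candidate c \in B)) => cB; case: (spy) => /=; [|lia| |lia].
  case: b {ans} spyish => spyish /=; first lia.
  (* Without supporters and not yet outvoted, the spy candidate is at height -1; the accusation
     resets it to 0. *)
  by have := spyish erefl cB; case: eqP; lia.
by case: (b) => /=; [lia|case: eqP; lia].
Qed.

Lemma rejections_poll b l B s (spy : bool) L rej c i :
  invariant b l B s L rej c ->
  size (accusers c) <= size (supporters c) ->
  i \in uninvolved (c :: rej) ->
  rejections (reveal B i spy) rej (poll b B c i spy) =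
  rejections B rej c + (spy && (height B c == 1%R)).
Proof.
case=> uI BI bal thr _ _ bnd spyish sz ap iU.
have ci := candidate_neq iU.
have ans := answer_reveal b spy BI iU.
have iU' : i \in uninvolved rej.
  by move: iU; rewrite !in_set involved_cons in_cons mem_cat !negb_or => /and3P[].
rewrite /rejections /height rejected_knights_reveal //.
rewrite /poll in_reveal //= ans size_supporters_cons size_accusers_cons.
have -> : (size (supporters c) < size (accusers c)) = false by lia.
rewrite addn0; congr (_ + _).
clear - ap; move: (size _) (size _) (_ \in _) ap => a p cB ap.
by case: spy; case: b; case: cB; rewrite /= ?andbT ?andbF //; lia.
Qed.

Lemma invariant_reject b l B s (spy : bool) L rej c i :
  invariant b l B (s + spy) L rej c ->
  size (supporters c) < size (accusers c) ->
  i \in uninvolved (c :: rej) ->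
  invariant b l (reveal B i spy) s (L - size (accusers c)) (c :: rej)
    (Candidacy i [::]).
Proof.
case=> uI BI bal thr pL ap bnd spyish sz pa iU.
have iB := spies_notin BI iU.
have aE : size (accusers c) = (size (supporters c)).+1 by lia.
(* An outvoted candidacy accounts for as many spies as accusers, so [L - size (accusers c)] is not
   truncated. *)
have aL : size (accusers c) <= L by move: bnd; case: ifP; lia.
have sz' : (L - size (accusers c)).*2 + size (involved (c :: rej)) < #|T|.
  by rewrite size_involved_cons; move: sz; lia.
split=> //=; rewrite ?in_reveal_self //.
- by move: iU; rewrite in_set => ->.
- exact: reveal_subset BI _.
- by rewrite bal andbT /balanced aE.
- by rewrite big_cons; move: thr aL; lia.
- by move: bnd; case: spy {iU}; case: ifP; lia.
Qed.

Lemma invariant_start b l s (spy : bool) i :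
  s + spy <= l -> l.*2 < #|T| ->
  invariant b l (reveal set0 i spy) s l [::] (Candidacy i [::]).
Proof.
move=> sl lT; split=> //=; rewrite ?in_reveal_self ?inE ?big_nil //.
- by apply: (@reveal_subset _ _ _ [::]) => //; apply/subsetP => x; rewrite inE.
- by case: spy sl; lia.
- by rewrite addn0.
Qed.

Lemma height_start B i spy : i \notin B ->
  height (reveal B i spy) (Candidacy i [::]) = (if spy then -1 else 1)%R.
Proof. by move=> iB; rewrite /height in_reveal_self. Qed.

Lemma rejections_reject B i spy rej c :
  size (supporters c) < size (accusers c) ->
  i \in uninvolved (c :: rej) ->
  rejections (reveal B i spy) (c :: rej) (Candidacy i [::]) =
  rejections B rej c.
Proof.
move=> pa iU; rewrite /rejections rejected_knights_reveal //= pa addn0.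
by rewrite /rejected_knights /= addnC.
Qed.

(** * Step 1 summed over the positions of the uninvolved spies *)

Lemma answer_reveal_setU b B c rej i spy X :
  i \in uninvolved (c :: rej) -> X \subset uninvolved (c :: rej) :\ i ->
  answer b (reveal B i spy :|: X) i (candidate c) =
  answer b (reveal B i spy) i (candidate c).
Proof.
move=> iU XU; have iX : i \notin X by move: XU; rewrite subsetD1 => /andP[].
have cX : candidate c \notin X.
  apply/negP => /(subsetP XU); rewrite in_setD1 in_set involved_cons.
  by rewrite mem_head andbF.
by rewrite /answer !inE (negbTE iX) (negbTE cX) !orbF.
Qed.

Lemma size_questions_accept b l B s L rej c X :
  invariant b l B s L rej c ->
  size (accusers c) <= size (supporters c) -> L <= size (supporters c) ->
  X \subset uninvolved (c :: rej) ->
  (size (questions (answer b (B :|: X)) (rej, c)) + rejections B rej c).+1 =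
  #|T| + l.
Proof.
case=> uI _ bal thr pL _ bnd _ _ ap Lp XU.
have XN x : x \in involved (c :: rej) -> x \notin X.
  by move=> xI; apply/negP => /(subsetP XU); rewrite in_set xI.
have cB : candidate c \notin B.
  (* A spy with [L] supporters would account for more than [L] spies. *)
  by apply/negP => cB; move: bnd; rewrite cB; lia.
have pE : size (supporters c) = L by apply/eqP; rewrite eqn_leq pL.
have -> : rejections B rej c = rejected_knights (B :|: X) rej.
  rewrite /rejections ltnNge ap addn0; apply: eq_rejected_knights => x xI.
  by rewrite inE (negbTE (XN x _)) ?orbF // involved_cons inE mem_cat xI !orbT.
apply: size_questions => //; first by rewrite pE.
by rewrite inE negb_or cB XN // involved_cons mem_head.
Qed.

Lemma invariant_room b l B s L rej c :
  invariant b l B s L rej c ->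
  (size (supporters c) < size (accusers c)) || (size (supporters c) < L) ->
  size (involved (c :: rej)) < #|T|.
Proof.
case=> _ _ _ _ pL ap bnd _ sz; rewrite size_involved_cons => room.
apply: leq_ltn_trans sz; move: bnd pL ap room.
by case: ifP => _; lia.
Qed.

(** Induction on the fuel, which covers each uninvolved person and the accepting call. [phi] takes
    the number of questions and [psi] the number of rejected knights. *)
Lemma sum_step1 (R : nmodType) (phi psi : nat -> R) b l fuel B s L rej c :
  (forall x j, (x + j).+1 = #|T| + l -> phi x = psi j) ->
  invariant b l B s L rej c -> #|uninvolved (c :: rej)| < fuel ->
  (\sum_(X : {set T} | (X \subset uninvolved (c :: rej)) && (#|X| == s))
     phi (size (questions (answer b (B :|: X))
                 (step1 pick (answer b (B :|: X)) fuel L rej c)))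
   = walk_sum psi b #|uninvolved (c :: rej)| (height B c) s
       (rejections B rej c))%R.
Proof.
move=> phipsi; elim: fuel B s L rej c => // f IHf B s L rej c inv ltf.
have setUE i X : B :|: (i |: X) = reveal B i true :|: X by rewrite setUCA setUA.
have [accept|proceed] := boolP
    ((size (accusers c) <= size (supporters c)) && (L <= size (supporters c))).
  have [ap Lp] := andP accept.
  (* From acceptance on the walk stays positive, so both sides are constant over the choices of
     [X]. *)
  have high : (s%:Z < height B c)%R.
    case: inv => _ _ _ _ pL _ bnd _ _; move: bnd; rewrite /height.
    by case: ifP; lia.
  rewrite walk_sum_high // -cards_draws -sumr_const /=.
  under [RHS]eq_bigl do rewrite inE.
  apply: eq_bigr => X /andP[XU _].
  rewrite /= ltnNge ap Lp /=; apply: phipsi.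
  exact: size_questions_accept inv ap Lp XU.
have pickU : pick (c :: rej) \in uninvolved (c :: rej).
  apply/pick_uninvolved/(invariant_room inv).
  by rewrite !ltnNge -negb_and.
move iE: (pick (c :: rej)) pickU => i iU.
have iB : i \notin B by apply: spies_notin iU; case: inv.
have UE : #|uninvolved (c :: rej)| = #|uninvolved (c :: rej) :\ i|.+1.
  by rewrite (cardsD1 i) iU.
rewrite UE ltnS in ltf.
rewrite (sum_subsets_split _ _ iU) UE [RHS]/=.
have [pa|ap] := ltnP (size (supporters c)) (size (accusers c)).
  have z0 : height B c = 0%R.
    by rewrite /height; case: inv => _ _ _ _ _ ? _ _ _; case: ifP; lia.
  have next t (spy : bool) : s = t + spy ->
    (\sum_(X : {set T} | (X \subset uninvolved (c :: rej) :\ i) && (#|X| == t))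
      phi (size (questions (answer b (reveal B i spy :|: X))
        (step1 pick (answer b (reveal B i spy :|: X)) f.+1 L rej c)))
     = walk_sum psi b #|uninvolved (c :: rej) :\ i| (if spy then -1 else 1) t
        (rejections B rej c))%R.
    move=> sE; rewrite sE in inv; rewrite -uninvolved_next.
    rewrite -(height_start spy iB) -(rejections_reject B spy pa iU).
    rewrite -(IHf _ _ _ _ _ (invariant_reject inv pa iU)).
      by apply: eq_bigr => X _; rewrite /= pa iE.
    by rewrite uninvolved_next.
  rewrite (next s false) ?addn0 // z0 add0r; congr (_ + _)%R.
  case: s inv next => // s inv next; under eq_bigr do rewrite setUE.
  by rewrite (next s true) ?addn1 // addn0; case: (b).
have pL : size (supporters c) < L by move: proceed; rewrite ap /= ltnNge.
have next t (spy : bool) : s = t + spy ->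
  (\sum_(X : {set T} | (X \subset uninvolved (c :: rej) :\ i) && (#|X| == t))
    phi (size (questions (answer b (reveal B i spy :|: X))
      (step1 pick (answer b (reveal B i spy :|: X)) f.+1 L rej c)))
   = walk_sum psi b #|uninvolved (c :: rej) :\ i|
      (if spy then spy_step b (height B c) else height B c + 1) t
      (rejections B rej c + (spy && (height B c == 1%R)))%N)%R.
  move=> sE; rewrite sE in inv.
  rewrite -(height_poll spy inv ap iU) -(rejections_poll spy inv ap iU).
  rewrite -(uninvolved_poll c rej i (answer b (reveal B i spy) i (candidate c))).
  have inv' : invariant b l (reveal B i spy) t L rej (poll b B c i spy).
    by apply: invariant_poll inv _ iU; rewrite ap.
  rewrite -(IHf _ _ _ _ _ inv'); last by rewrite uninvolved_poll.
  apply: eq_bigr => X; rewrite uninvolved_poll => /andP[XU _].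
  rewrite /= ltnNge ap [L <= _]leqNgt pL /= iE.
  (* The reply depends only on [i] and the candidate, both revealed, hence not on [X]. *)
  by rewrite (answer_reveal_setU _ _ _ iU XU).
rewrite (next s false) ?addn0 //; congr (_ + _)%R.
case: s inv next => // s inv next; under eq_bigr do rewrite setUE.
by rewrite (next s true) ?addn1.
Qed.

(** The first candidate is picked before [step1] runs and gives the first step of the walk. *)
Lemma sum_spider (R : nmodType) (phi psi : nat -> R) b s l :
  (forall x j, (x + j).+1 = #|T| + l -> phi x = psi j) ->
  s <= l -> l.*2 < #|T| ->
  (\sum_(S in spy_sets T s) phi (num_questions pick l b S)
   = walk_sum psi b #|T| 0 s 0)%R.
Proof.
move=> phipsi sl lT.
have iU : pick [::] \in [set: T] by [].
have TE : #|T| = #|[set: T] :\ pick [::]|.+1 by rewrite -cardsT (cardsD1 (pick [::])) iU.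
have UE : uninvolved [:: Candidacy (pick [::]) [::]] = [set: T] :\ pick [::].
  by apply/setP => x; rewrite !inE andbT.
have next t (spy : bool) : s = t + spy ->
    (\sum_(X : {set T} | (X \subset [set: T] :\ pick [::]) && (#|X| == t))
      phi (num_questions pick l b (reveal set0 (pick [::]) spy :|: X))
     = walk_sum psi b #|[set: T] :\ pick [::]| (if spy then -1 else 1) t 0)%R.
  move=> sE; rewrite sE in sl.
  have i0 : pick [::] \notin set0 by rewrite inE.
  have := sum_step1 phipsi (invariant_start b (pick [::]) sl lT) (fuel := #|T|).
  rewrite UE height_start // => <-; last by rewrite TE.
  apply: eq_bigr => X _; rewrite /num_questions /spider_questions.
  by case: step1.
transitivity (\sum_(X : {set T} | (X \subset [set: T]) && (#|X| == s))
    phi (num_questions pick l b X))%R.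
  by apply: eq_bigl => S; rewrite inE subsetT.
rewrite (sum_subsets_split _ _ iU) TE [RHS]/= add0r.
congr (_ + _)%R.
  by rewrite -(next s false) ?addn0 //; apply: eq_bigr => X _; rewrite set0U.
case: s {sl} next => // s next.
have -> : spy_step b 0 = (- 1)%R by case: (b).
by rewrite -(next s true) ?addn1 //; apply: eq_bigr => X _; rewrite /reveal setU0.
Qed.

End Interrogation.

Theorem theorem1 (k s l : nat) (pick : selection_rule 'I_(k + s))
    (hpick : picks_uninvolved pick)
    (hl : (0 < l)%N) (hsl : (s <= l)%N) (hln : (l.*2 < k + s)%N) :
  (forall q : nat,
     prob s (fun S => num_questions pick l Knavish S == q) =
     prob s (fun S => num_questions pick l Spyish S == q))
  /\
  (forall b : behaviour,
     expectation s (fun S =>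
       (k + s + l)%N%:R - 1 - (num_questions pick l b S)%:R) =
     ('C(k + s, s)%:R)^-1 * \sum_(0 <= r < s) 'C(k + s, r)%:R)%R.
Proof.
have lT : l.*2 < #|'I_(k + s)| by rewrite card_ord.
have walkE (psi : nat -> rat) b :
    walk_sum psi b (k + s) 0 s 0 = walk_sum psi Knavish (k + s) 0 s 0.
  by case: b => //; apply: walk_sum_spyish; lia.
split=> [q|b].
  (* Indicator functions as [phi] and [psi] give the distribution; [psi] is the same for both
     behaviours. *)
  have countE b : (#|[set S in spy_sets 'I_(k + s) s
                       | num_questions pick l b S == q]|%:R =
      walk_sum (fun j => ((q + j).+1 == k + s + l)%N%:R : rat) Knavish
        (k + s) 0 s 0)%R.
    have phipsi x j : (x + j).+1 = #|'I_(k + s)| + l ->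
        (x == q)%:R%R = ((q + j).+1 == k + s + l)%N%:R%R :> rat.
      rewrite card_ord => xj; congr ((nat_of_bool _)%:R)%R.
      by apply/eqP/eqP; lia.
    have := sum_spider hpick b phipsi hsl lT.
    rewrite [X in walk_sum _ _ X _ _ _]card_ord walkE => <-.
    rewrite -sum1_card natr_sum [RHS]big_mkcond /= [LHS]big_mkcond /=.
    apply: eq_bigr => S _; rewrite !inE.
    by case: (_ == s); case: (_ == q).
  by rewrite /prob !countE.
have cardE : #|spy_sets 'I_(k + s) s| = 'C(k + s, s).
  by rewrite /spy_sets card_draws card_ord.
rewrite /expectation cardE mulrC; congr (_ * _)%R.
have phipsi x j : (x + j).+1 = #|'I_(k + s)| + l ->
    ((k + s + l)%:R - 1 - x%:R)%R = j%:R%R :> rat.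
  by rewrite card_ord => <-; rewrite -addn1 !natrD addrK addrAC subrr add0r.
rewrite (sum_spider hpick b phipsi hsl lT) [X in walk_sum _ _ X _ _ _]card_ord.
rewrite walkE walk_sum_mean mul0n addn0 /bin_psum /= natr_sum.
(* The hypotheses give [s <= k], so the bound at height 0 is [s]. *)
have -> : minn s (k + s - s) = s by lia.
by rewrite big_mkord.
Qed.
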